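(* Let $f:\{0,1\}^n\to\{0,1\}$ be a Boolean function and let $\Phi=\sum_{x,x'\in\{0,1\}^n}(-1)^{f(x)}(-1)^{f(x')}|x'\rangle\langle x|$ be the Gram matrix corresponding to computing $f$ in the phase. For every $\varepsilon$ with $0\le\varepsilon\le1$, $$\mathrm{xpoly}_\varepsilon(\Phi)\ \ge\ \widetilde{\deg}_{\varepsilon/2}(f).$$
   Context: All matrices are complex matrices with rows and columns indexed by $\{0,1\}^n$; $\circ$ is the entrywise (Hadamard) product, $\mathbb I$ the identity, and $A\succeq 0$ means Hermitian positive semidefinite. A Gram matrix (always normalized) is a matrix $A\succeq 0$ with $A\circ\mathbb I=\mathbb I$ (all diagonal entries equal to 1). Fidelity: for density matrices $\rho,\sigma$ (positive semidefinite, trace 1), $\mathcal F(\rho,\sigma)=\mathrm{tr}\sqrt{\sqrt\rho\,\sigma\sqrt\rho}$. Hadamard product fidelity: for Gram matrices $A,B$, $\mathcal F_H(A,B)=\min_{u:\|u\|=1}\mathcal F(A\circ|u\rangle\langle u|,\,B\circ|u\rangle\langle u|)$, the minimum being over unit vectors $u\in\mathbb C^{\{0,1\}^n}$. Fourier basis: subsets $S\subseteq\{1,\dots,n\}$ are identified with their characteristic vectors in $\{0,1\}^n$, $|S|$ is the cardinality, and $|\chi_S\rangle=\frac1{\sqrt{2^n}}\sum_x(-1)^{S\cdot x}|x\rangle$. Extended polynomial bounds: for a Gram matrix $M$ and $0\le\varepsilon\le1$, $\mathrm{xpoly}_0(M)=\max_S\{|S|:\langle\chi_S|M|\chi_S\rangle\neq0\}$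 and $\mathrm{xpoly}_\varepsilon(M)=\min_N\{\mathrm{xpoly}_0(N):\mathcal F_H(N,M)\ge\sqrt{1-\varepsilon},\ N\succeq0,\ N\circ\mathbb I=\mathbb I\}$. Approximate degree: for $\eta\ge0$, $\widetilde{\deg}_\eta(f)=\min_p\{\deg(p):|p(x)-f(x)|\le\eta\ \text{for all }x\in\{0,1\}^n\}$, the minimum being over real $n$-variate polynomials $p:\mathbb R^n\to\mathbb R$ (constants, including the zero polynomial, have degree 0). *)

(* Defs.v *)
From mathcomp Require Import all_boot all_order all_algebra.
From mathcomp Require Import boolp classical_sets reals complex.
From mathcomp Require Import (coercions, canonicals) mpoly.

Set Implicit Arguments.
Unset Strict Implicit.
Unset Printing Implicit Defensive.
Import Order.TTheory GRing.Theory Num.Theory Num.Def.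
Local Open Scope classical_set_scope.
Local Open Scope ring_scope.
Local Open Scope sesquilinear_scope.

(* The least element of E, when there is one. The default value x0 plays no
   role below: [hfidelity] minimizes a continuous function over a compact
   sphere, and [xpoly] and [approx_deg] minimize over nonempty sets of natural
   numbers. *)
Definition minimum {d : Order.disp_t} {T : porderType d} (x0 : T)
    (E : set T) : T :=
  xget x0 [set m | E m /\ forall y, E y -> (m <= y)%O].

Notation cube n := {ffun 'I_n -> bool}.

(* Matrices over C with rows and columns indexed by {0,1}^n, through the
   bijection [enum_rank] between [cube n] and ['I_#|cube n|]. *)
Notation cubemx R n := 'M[R[i]]_#|{: cube n}|.
Notation cubecV R n := 'cV[R[i]]_#|{: cube n}|.

Definition psdmx {C : numClosedFieldType} {m : nat} (A : 'M[C]_m) : Prop :=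
  A \is hermsymmx /\ forall v : 'cV[C]_m, 0 <= (v ^t* *m A *m v) 0 0.

Definition hadamard {C : numClosedFieldType} {m : nat} (A B : 'M[C]_m) :
  'M[C]_m := map2_mx *%R A B.

Definition gram {C : numClosedFieldType} {m : nat} (A : 'M[C]_m) : Prop :=
  psdmx A /\ hadamard A 1%:M = 1%:M.

(* Square root by functional calculus: A = P^-1 D P with P unitary and D
   diagonal whenever A is normal (see [orthomx_spectralP]). *)
Definition sqrtmx {C : numClosedFieldType} {m : nat} (A : 'M[C]_m) : 'M[C]_m :=
  invmx (spectralmx A) *m diag_mx (map_mx sqrtC (spectral_diag A))
    *m spectralmx A.

(* The trace is a nonnegative real number when rho and sigma are positive
   semidefinite; [complex.Re] only brings it into the type R. *)
Definition fidelity {R : realType} {m : nat} (rho sigma : 'M[R[i]]_m) : R :=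
  complex.Re (\tr (sqrtmx (sqrtmx rho *m sigma *m sqrtmx rho))).

Definition unitvec {C : numClosedFieldType} {m : nat} (u : 'cV[C]_m) : Prop :=
  sqrtC (\sum_i `|u i 0| ^+ 2) = 1.

Definition hfidelity {R : realType} {m : nat} (A B : 'M[R[i]]_m) : R :=
  minimum 0 [set fidelity (hadamard A (u *m u ^t*)) (hadamard B (u *m u ^t*))
            | u in [set u : 'cV[R[i]]_m | unitvec u]].

Definition ket {R : realType} {n : nat} (x : cube n) : cubecV R n :=
  delta_mx (enum_rank x) 0.

Definition chi {R : realType} {n : nat} (S : {set 'I_n}) : cubecV R n :=
  (sqrtC (2 ^+ n))^-1 *: \sum_(x : cube n) (-1) ^+ (\sum_(i in S) x i)%N *: ket x.

Definition xpoly0 {R : realType} {n : nat} (M : cubemx R n) : nat :=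
  \max_(S : {set 'I_n} | ((chi S) ^t* *m M *m chi S) 0 0 != 0) #|S|.

Definition xpoly {R : realType} {n : nat} (eps : R) (M : cubemx R n) : nat :=
  minimum 0%N [set xpoly0 N | N in [set N : cubemx R n |
    hfidelity N M >= Num.sqrt (1 - eps) /\ gram N]].

(* [mpoly.mpoly n R] is the type {mpoly R[n]} of n-variate polynomials, and
   [mpoly.msize p] is 1 + deg p, or 0 if p = 0. *)
Definition approx_deg {R : realType} {n : nat} (eta : R) (f : cube n -> bool) :
    nat :=
  minimum 0%N [set (mpoly.msize p).-1 | p in [set p : mpoly.mpoly n R |
    forall x : cube n,
      `|mpoly.meval (fun i => (x i)%:R) p - (f x)%:R| <= eta]].

Definition phase_gram (R : realType) {n : nat} (f : cube n -> bool) :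
    cubemx R n :=
  \sum_(x : cube n) \sum_(x' : cube n)
    ((-1) ^+ f x * (-1) ^+ f x') *: (ket x' *m (ket x) ^t*).

(* Main.v *)
(* Write s = (-1)^f and let N be a Gram matrix admissible in xpoly. Since
   Phi o |u><u| has rank one,
   F(N o |u><u|, Phi o |u><u|)^2 = q^T H q, where
   q = |u|^2 entrywise and H_xy = s_x s_y Re N_xy. As u varies, q runs over the
   probability simplex, so a vector u attaining the Hadamard fidelity minimizes
   a quadratic form there, and first-order optimality gives
   (H q)_x >= q^T H q >= 1 - eps for every x; also (H q)_x <= 1 because
   |H_xy| <= 1. Hence g = s (H q) = Re (N b), with b = s q, satisfies
   1 - eps <= s g <= 1, so (1 - g) / 2 is within eps / 2 of f. Finally
   <chi_S|N|chi_S> = 0 forces <chi_S|N = 0, so the Fourier expansion of N b only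
   involves sets S with |S| <= xpoly_0(N). *)

Require Import Defs.
From mathcomp Require Import all_boot all_order all_algebra.
From mathcomp Require Import boolp classical_sets reals complex mpoly.
From mathcomp Require Import ring lra.

Set Implicit Arguments.
Unset Strict Implicit.
Unset Printing Implicit Defensive.
Import Order.TTheory GRing.Theory Num.Theory.
Local Open Scope ring_scope.
Local Open Scope sesquilinear_scope.

(** * Positive semidefinite matrices and their square roots *)

Section PositiveSemidefinite.
Variable C : numClosedFieldType.

Lemma trmxC_mul m n p (A : 'M[C]_(m, n)) (B : 'M[C]_(n, p)) :
  (A *m B) ^t* = B ^t* *m A ^t*.
Proof. by rewrite trmx_mul map_mxM. Qed.

Lemma trmxC_hermitian m (A : 'M[C]_m) : A \is hermsymmx -> A ^t* = A.
Proof. by move/is_hermitianmxP; rewrite expr0 scale1r => <-. Qed.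

Lemma quad_mxE m (A : 'M[C]_m) (u v : 'cV[C]_m) :
  (u ^t* *m A *m v) 0 0 = \sum_i \sum_j (u i 0)^* * A i j * v j 0.
Proof.
rewrite mxE exchange_big; apply: eq_bigr => j _.
by rewrite mxE mulr_suml; apply: eq_bigr => i _; rewrite !mxE.
Qed.

Lemma dotE m (u : 'cV[C]_m) : (u ^t* *m u) 0 0 = \sum_i `|u i 0| ^+ 2.
Proof. by rewrite mxE; apply: eq_bigr => i _; rewrite !mxE mulrC -normCK. Qed.

Lemma dot_eq0 m (u : 'cV[C]_m) : (u ^t* *m u) 0 0 = 0 -> u = 0.
Proof.
rewrite dotE => /eqP; rewrite psumr_eq0 => [/allP u0|i _]; last first.
  by rewrite exprn_ge0.
apply/matrixP => i j; rewrite ord1 mxE; apply/eqP.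
by have := u0 i (mem_index_enum _); rewrite sqrf_eq0 normr_eq0.
Qed.

Lemma spectral_diag_psd m (A : 'M[C]_m) (i : 'I_m) :
  psdmx A -> 0 <= spectral_diag A 0 i.
Proof.
move=> [hA pA]; set P := spectralmx A.
have := pA ((row i P) ^t*); rewrite trmxCK.
have uP : P \is unitarymx by exact: spectral_unitarymx.
have /hermitian_normalmx/orthomx_spectralP eA := hA.
have -> : row i P *m A *m (row i P)^t*
    = row i (P *m A *m P^t*) *m (delta_mx 0 i)^T.
  rewrite !row_mul rowE trmxC_mul -!mulmxA; congr (_ *m (_ *m (_ *m (_ *m _)))).
  by rewrite trmx_delta map_delta_mx.
rewrite {1}eA -/P !mulmxA mulmxV ?unitarymx_unit // mul1mx -mulmxA.
by rewrite (unitarymxP uP) mulmx1 trmx_delta -colE !mxE eqxx.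
Qed.

(** Uniqueness of the nonnegative root. [sqrtmx] works in whatever eigenbasis [spectralmx] picks for
    [B *m B], which need not be P; the change of basis W compares the two diagonalizations. *)
Lemma sqrtmx_diag_conj m (P : 'M[C]_m) (E : 'rV[C]_m) :
  P \in unitmx -> (forall i, 0 <= E 0 i) ->
  let B := invmx P *m diag_mx E *m P in
  B *m B \is normalmx -> sqrtmx (B *m B) = B.
Proof.
move=> uP E0 B nB; set A := B *m B in nB *.
rewrite /sqrtmx; set Q := spectralmx A; set D := spectral_diag A.
have /orthomx_spectralP := nB; rewrite -/Q -/D => eA.
have uQ : Q \in unitmx by exact/unitarymx_unit/spectral_unitarymx.
pose W := P *m invmx Q.
have WD : W *m diag_mx D = diag_mx E *m diag_mx E *m W.
  have: P *m A *m invmx Q = P *m (B *m B) *m invmx Q by [].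
  rewrite {1}eA /B !mulmxA mulmxV // mul1mx -!mulmxA mulmxV // mulmx1.
  by rewrite !mulmxA mulmxK // => <-; rewrite /W.
(* W intertwines D and E^2; since E >= 0, it intertwines sqrt D and E. *)
have WS : W *m diag_mx (map_mx sqrtC D) = diag_mx E *m W.
  move: W WD => W WD; apply/matrixP => i j; have /matrixP/(_ i j) := WD.
  rewrite mulmx_diag !mul_mx_diag !mul_diag_mx !mxE.
  have [->|W0] := eqVneq (W i j) 0; first by rewrite !mul0r !mulr0.
  rewrite [RHS]mulrC => /(mulfI W0) ->.
  by rewrite -expr2 sqrCK // mulrC.
have : invmx P *m (W *m diag_mx (map_mx sqrtC D)) *m Q
     = invmx P *m (diag_mx E *m W) *m Q by rewrite WS.
by rewrite /W !mulmxA mulVmx // mul1mx mulmxKV.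
Qed.

Lemma sqrtmxK m (A : 'M[C]_m) : psdmx A -> sqrtmx A *m sqrtmx A = A.
Proof.
move=> [hA _]; have /hermitian_normalmx/orthomx_spectralP eA := hA.
have uP : spectralmx A \in unitmx by exact/unitarymx_unit/spectral_unitarymx.
rewrite /sqrtmx -!mulmxA (mulKVmx uP) [in RHS]eA -!mulmxA; congr (_ *m _).
rewrite mulmxA mulmx_diag; congr (diag_mx _ *m _).
by apply/rowP => i; rewrite !mxE -expr2 sqrtCK.
Qed.

Lemma sqrtmx_herm m (A : 'M[C]_m) : psdmx A -> (sqrtmx A) ^t* = sqrtmx A.
Proof.
move=> pA; rewrite /sqrtmx.
have uP : spectralmx A \is unitarymx by exact: spectral_unitarymx.
rewrite !trmxC_mul invmx_unitary // trmxCK mulmxA; congr (_ *m _ *m _).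
apply/matrixP => i j; rewrite !mxE.
rewrite rmorphMn /= eq_sym; case: eqVneq => [->|]; rewrite ?mulr0n // !mulr1n.
by apply: conj_Creal; apply: ger0_real; rewrite sqrtC_ge0 spectral_diag_psd.
Qed.

Lemma sqrtmx_sqr m (B : 'M[C]_m) : psdmx B -> sqrtmx (B *m B) = B.
Proof.
move=> pB; have [hB _] := pB; have /hermitian_normalmx/orthomx_spectralP eB := hB.
have nBB : B *m B \is normalmx.
  by apply/normalmxP; rewrite trmxC_mul (trmxC_hermitian hB).
rewrite eB in nBB *; apply: sqrtmx_diag_conj nBB.
  exact/unitarymx_unit/spectral_unitarymx.
by move=> i; exact: spectral_diag_psd.
Qed.

Lemma psdmx_outer m (c : C) (z : 'cV[C]_m) : 0 <= c -> psdmx (c *: (z *m z ^t*)).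
Proof.
move=> c0; split.
  apply/is_hermitianmxP; rewrite expr0 scale1r.
  rewrite !linearZ /= map_mxZ /= trmxC_mul trmxCK conj_Creal //.
  exact: ger0_real.
move=> v; rewrite -scalemxAr -scalemxAl mxE mulr_ge0 //.
rewrite mulmxA -(mulmxA _ (z^t*)) mxE big_ord1.
have -> : (z^t* *m v) 0 0 = ((v^t* *m z) 0 0)^*.
  by rewrite -[in LHS](trmxCK v) -trmxC_mul !mxE.
by rewrite -normCK exprn_ge0.
Qed.

(** The square of z z^* is |z|^2 z z^*, so z z^* / |z| is a positive semidefinite root, and such a
    root is unique. For z = 0 both sides vanish. *)
Lemma sqrtmx_outer m (z : 'cV[C]_m) :
  sqrtmx (z *m z ^t*) = (sqrtC ((z ^t* *m z) 0 0))^-1 *: (z *m z ^t*).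
Proof.
set a := sqrtC _.
have a2 : (z ^t* *m z) 0 0 = a ^+ 2 by rewrite sqrtCK.
have a0 : 0 <= a.
  by rewrite sqrtC_ge0 dotE sumr_ge0 // => i _; rewrite exprn_ge0.
rewrite -[in RHS](sqrtmx_sqr (psdmx_outer z _)) ?invr_ge0 //; congr sqrtmx.
rewrite -scalemxAr -scalemxAl scalerA.
rewrite -mulmxA (mulmxA (z^t*)) (mx11_scalar (_ *m z)) a2.
rewrite mul_scalar_mx -scalemxAr scalerA.
have [a00|an0] := eqVneq a 0.
  move: a2; rewrite a00 expr0n /= => /dot_eq0 ->.
  by rewrite mul0mx scaler0.
by rewrite (_ : _ * _ = 1) ?scale1r //; field.
Qed.

(** With S the root of A, the quadratic form at v is |S v|^2; so S v = 0, and v^* A = (S v)^* S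
    vanishes too. *)
Lemma psdmx_ker m (A : 'M[C]_m) (v : 'cV[C]_m) :
  psdmx A -> (v ^t* *m A *m v) 0 0 = 0 -> v ^t* *m A = 0.
Proof.
move=> pA; rewrite -{1}(sqrtmxK pA) -mulmxA -mulmxA (mulmxA (v^t*)).
rewrite -{1}(sqrtmx_herm pA) -trmxC_mul => /dot_eq0 Sv0.
rewrite -[A in LHS](sqrtmxK pA) mulmxA -{1}(sqrtmx_herm pA) -trmxC_mul Sv0.
by rewrite trmx0 map_mx0 mul0mx.
Qed.

(** The form of the product at v is the form of A at the entrywise product of v with the conjugate
    of u. *)
Lemma psdmx_hadamard_outer m (A : 'M[C]_m) (u : 'cV[C]_m) :
  psdmx A -> psdmx (hadamard A (u *m u ^t*)).
Proof.
move=> [hA pA]; split.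
  apply/is_hermitianmxP; rewrite expr0 scale1r; apply/matrixP => i j.
  have /matrixP/(_ i j) := trmxC_hermitian hA; rewrite !mxE => <-.
  rewrite !big_ord1 !mxE !rmorphM /= !conjCK; ring.
move=> v; have := pA (\col_i ((u i 0)^* * v i 0)); congr (0 <= _).
rewrite !quad_mxE; apply: eq_bigr => i _; apply: eq_bigr => j _.
rewrite !mxE big_ord1 !mxE rmorphM /= conjCK; ring.
Qed.

End PositiveSemidefinite.


(** * Attained minima, and first-order optimality on the simplex *)

Lemma minimum_eq d (T : porderType d) (x0 m : T) (E : set T) :
  E m -> (forall y, E y -> (m <= y)%O) -> minimum x0 E = m.
Proof.
move=> Em lem; rewrite /minimum; case: xgetP => [y -> [Ey ley]|/(_ m)]; last by case.
by apply/eqP; rewrite eq_le ley ?lem.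
Qed.

Lemma minimum_nat (x0 : nat) (E : set nat) k : E k ->
  E (minimum x0 E) /\ (minimum x0 E <= k)%N.
Proof.
move=> Ek; have exE : exists k, `[< E k >] by exists k; exact/asboolP.
case: (ex_minnP exE) => m /asboolP Em lem.
rewrite (@minimum_eq _ nat x0 m E) //.
  by split => //; apply/lem/asboolP.
by move=> y Ey; apply/lem/asboolP.
Qed.

Lemma simplex_minimizer (F : realFieldType) m (H : 'I_m -> 'I_m -> F)
    (q : 'I_m -> F) (i : 'I_m) :
  let Q p := \sum_i \sum_j p i * p j * H i j in
  (forall i j, H i j = H j i) -> (forall i, H i i = 1) ->
  (forall i, 0 <= q i) -> \sum_i q i = 1 ->
  (forall p, (forall i, 0 <= p i) -> \sum_i p i = 1 -> Q q <= Q p) ->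
  Q q <= \sum_j H i j * q j.
Proof.
(* Compare q with its perturbation (1 - t) q + t e_i towards the vertex e_i. *)
move=> Q Hsym H1 q0 q1 qmin; set a := \sum_j _.
have Qt t : Q (fun j => (1 - t) * q j + t * (j == i)%:R)
          = (1 - t) ^+ 2 * Q q + 2 * t * (1 - t) * a + t ^+ 2.
  have eL (g : 'I_m -> F) : \sum_k (k == i)%:R * g k = g i.
    rewrite (bigD1 i) //= eqxx mul1r big1 ?addr0 // => k /negPf ->.
    by rewrite mul0r.
  transitivity (\sum_k ((1 - t) ^+ 2 * (\sum_j q k * q j * H k j)
      + (1 - t) * t * (q k * H k i)
      + (k == i)%:R * (t * (1 - t) * a + t ^+ 2))).
    apply: eq_bigr => k _.
    have eR : \sum_j (j == i)%:R * H k j = H k i by rewrite eL.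
    transitivity (\sum_j ((1 - t) ^+ 2 * (q k * q j * H k j)
        + (1 - t) * t * q k * ((j == i)%:R * H k j)
        + (k == i)%:R * (t * (1 - t) * (H k j * q j))
        + (k == i)%:R * t ^+ 2 * ((j == i)%:R * H k j))).
      by apply: eq_bigr => j _; ring.
    rewrite !big_split /= -!mulr_sumr eR.
    case: eqVneq => [->|_]; rewrite ?mulr0n ?mulr1n; last by ring.
    rewrite H1 -/a; ring.
  rewrite !big_split /= -!mulr_sumr eL.
  have -> : \sum_k q k * H k i = a.
    by apply: eq_bigr => k _; rewrite Hsym mulrC.
  rewrite -/(Q q); ring.
rewrite leNgt; apply/negP => aQ.
(* By [Qt], the perturbation lowers Q by t (2 d - t (Q q - 2 a + 1)), which is positive once t K < 2
   d. The choice t = d / (d + K) lies in (0, 1] and gives t K = d - t d < d. *)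
pose d := Q q - a; pose K := `|Q q - 2 * a + 1|.
have d0 : 0 < d by rewrite subr_gt0.
have K0 : 0 <= K by exact: normr_ge0.
pose t := d / (d + K).
have dK0 : 0 < d + K by rewrite ltr_pwDl.
have t0 : 0 < t by rewrite divr_gt0.
have t1 : t <= 1 by rewrite ler_pdivrMr // mul1r lerDl.
have tK : t * K < 2 * d.
  have : t * (d + K) = d by rewrite divfK ?gt_eqF.
  have : 0 < t * d by rewrite mulr_gt0.
  lra.
have := qmin (fun j => (1 - t) * q j + t * (j == i)%:R).
rewrite Qt leNgt => /(_ _ _)/negP; apply.
- by move=> j; rewrite addr_ge0 // mulr_ge0 // ?subr_ge0 // ltW.
- rewrite big_split /= -!mulr_sumr q1 (bigD1 i) //= eqxx big1 => [|j /negPf -> //].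
  rewrite mulr1n; ring.
rewrite -subr_gt0.
have -> : Q q - ((1 - t) ^+ 2 * Q q + 2 * t * (1 - t) * a + t ^+ 2)
  = t * (2 * d - t * (Q q - 2 * a + 1)) by rewrite /d; ring.
rewrite mulr_gt0 // subr_gt0 (le_lt_trans _ tK) //.
by rewrite ler_wpM2l ?ler_norm // ltW.
Qed.

(** * Fidelity with a pure state *)

Section Fidelity.
Variable R : realType.
Implicit Types m : nat.

Lemma Re_sum (I : finType) (P : pred I) (F : I -> R[i]) :
  complex.Re (\sum_(i | P i) F i) = \sum_(i | P i) complex.Re (F i).
Proof. by apply: (big_morph (@complex.Re R)) => // -[a b] [c d]. Qed.

Lemma Re_Creal_mul (a : R) (z : R[i]) :
  complex.Re (a%:C%C * z) = a * complex.Re z.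
Proof. by case: z => x y /=; rewrite mul0r subr0. Qed.

Lemma Re_sqrtC (z : R[i]) : 0 <= z ->
  complex.Re (sqrtC z) = Num.sqrt (complex.Re z).
Proof.
case: z => a b; rewrite lecE /= => /andP[/eqP -> a0].
rewrite -[in LHS](sqr_sqrtr a0).
have -> : (Num.sqrt a ^+ 2 +i* 0)%C = ((Num.sqrt a)%:C%C) ^+ 2 :> R[i].
  by rewrite -rmorphXn.
by rewrite sqrCK // lecR sqrtr_ge0.
Qed.

(** With S the root of rho, S w w^* S is the outer square of S w, whose root has trace |S w|; and |S
    w|^2 = w^* rho w. *)
Lemma fidelity_pure m (rho : 'M[R[i]]_m) (w : 'cV[R[i]]_m) : psdmx rho ->
  fidelity rho (w *m w ^t*)
  = Num.sqrt (complex.Re ((w ^t* *m rho *m w) 0 0)).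
Proof.
move=> pr; rewrite /fidelity; set S := sqrtmx rho.
have SS : S *m S = rho by exact: sqrtmxK.
have Sh : S ^t* = S by exact: sqrtmx_herm.
have -> : S *m (w *m w ^t*) *m S = (S *m w) *m (S *m w) ^t*.
  by rewrite trmxC_mul Sh !mulmxA.
rewrite sqrtmx_outer mxtraceZ mxtrace_mulC /mxtrace big_ord1.
have -> : (S *m w)^t* *m (S *m w) = w^t* *m rho *m w.
  by rewrite trmxC_mul Sh -SS !mulmxA.
set z := _ 0 0; have z0 : 0 <= z by have [_ ->] := pr.
rewrite -Re_sqrtC // -[X in _ * X]sqrtCK expr2.
have [->|s0] := eqVneq (sqrtC z) 0; first by rewrite !mulr0.
by rewrite mulKf.
Qed.

(** The squared modulus lives in R and not in [R[i]], so that unit vectors give points of the real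
    simplex. *)
Definition sqmod m (u : 'cV[R[i]]_m) (i : 'I_m) : R :=
  complex.Re (u i 0) ^+ 2 + complex.Im (u i 0) ^+ 2.

Lemma sqmod_ge0 m (u : 'cV[R[i]]_m) i : 0 <= sqmod u i.
Proof. by rewrite addr_ge0 ?sqr_ge0. Qed.

Lemma sqmodE m (u : 'cV[R[i]]_m) i : (sqmod u i)%:C%C = u i 0 * (u i 0)^*.
Proof. by rewrite /sqmod add_Re2_Im2 normCK. Qed.

Lemma unitvecP m (u : 'cV[R[i]]_m) : unitvec u <-> \sum_i sqmod u i = 1.
Proof.
rewrite /unitvec.
have -> : \sum_i `|u i 0| ^+ 2 = (\sum_i sqmod u i)%:C%C.
  by rewrite rmorph_sum /=; apply: eq_bigr => i _; rewrite sqmodE normCK.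
split => [/(congr1 (fun z => z ^+ 2))|->]; last by rewrite rmorph1 sqrtC1.
by rewrite sqrtCK expr1n -[1]/(1%:C%C) => -[].
Qed.

Lemma sqmod_sqrt m (q : 'I_m -> R) : (forall i, 0 <= q i) ->
  sqmod (\col_i (Num.sqrt (q i))%:C%C) =1 q.
Proof. by move=> q0 i; rewrite /sqmod mxE /= sqr_sqrtr // expr0n addr0. Qed.

(** * Hadamard fidelity with a rank-one sign matrix *)

Section Phase.
Variables (m : nat) (s : 'I_m -> bool) (Phi : 'M[R[i]]_m).
Hypothesis PhiE : forall i j, Phi i j = (-1) ^+ s i * (-1) ^+ s j.

Lemma hadamard_phase (u : 'cV[R[i]]_m) :
  let w := \col_i ((-1) ^+ s i * u i 0) in
  hadamard Phi (u *m u ^t*) = w *m w ^t*.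
Proof.
apply/matrixP => i j; rewrite !mxE !big_ord1 !mxE PhiE rmorphM /= rmorph_sign.
ring.
Qed.

(** The matrix H of the outline. *)
Definition phase_re (N : 'M[R[i]]_m) (i j : 'I_m) : R :=
  (-1) ^+ s i * (-1) ^+ s j * complex.Re (N i j).

(** In the form of N o |u><u| at the vector with entries s_i u_i, each u_i meets its conjugate, so
    the phases of u cancel and only squared moduli remain. *)
Lemma fidelity_phase (N : 'M[R[i]]_m) (u : 'cV[R[i]]_m) : psdmx N ->
  fidelity (hadamard N (u *m u ^t*)) (hadamard Phi (u *m u ^t*))
  = Num.sqrt (\sum_i \sum_j sqmod u i * sqmod u j * phase_re N i j).
Proof.
move=> pN; rewrite hadamard_phase fidelity_pure; last exact: psdmx_hadamard_outer.
congr Num.sqrt; rewrite quad_mxE Re_sum; apply: eq_bigr => i _.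
rewrite Re_sum; apply: eq_bigr => j _.
rewrite /phase_re mulrA -Re_Creal_mul; congr complex.Re.
rewrite !rmorphM !rmorph_sign /= !sqmodE !mxE big_ord1 !mxE.
rewrite rmorphM /= rmorph_sign; ring.
Qed.

Lemma phase_re_sym (N : 'M[R[i]]_m) i j : psdmx N ->
  phase_re N i j = phase_re N j i.
Proof.
move=> [/trmxC_hermitian hN _]; rewrite /phase_re [X in X * _]mulrC; congr (_ * _).
by rewrite -[in LHS]hN !mxE; case: (N j i).
Qed.

Lemma gram_diag (N : 'M[R[i]]_m) i : gram N -> N i i = 1.
Proof. by move=> [_ /matrixP/(_ i i)]; rewrite !mxE eqxx mulr1. Qed.

Lemma phase_re_diag (N : 'M[R[i]]_m) i : gram N -> phase_re N i i = 1.
Proof.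
by move=> gN; rewrite /phase_re gram_diag //= -signr_addb addbb mul1r.
Qed.

(** Since N has unit diagonal, its form at s_i e_i - s_j e_j is 2 - 2 H_ij, which is nonnegative. *)
Lemma phase_re_le1 (N : 'M[R[i]]_m) i j : gram N -> phase_re N i j <= 1.
Proof.
move=> gN; have [pN _] := gN; have [_ nN] := pN.
pose a : R[i] := (-1) ^+ s i; pose b : R[i] := (-1) ^+ s j.
have := nN (a *: delta_mx i 0 - b *: delta_mx j 0).
have -> : (a *: delta_mx i 0 - b *: delta_mx j 0)^t*
    = a *: delta_mx 0 i - b *: delta_mx 0 j :> 'rV[R[i]]_m.
  apply/matrixP => k l; rewrite !mxE rmorphB !rmorphM /= !rmorph_sign.
  by rewrite !rmorph_nat /= ![_ && (_ == 0 :> 'I_1)]andbC.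
rewrite mulmxBl -!scalemxAl -!rowE mulmxBr -!scalemxAr -!colE.
rewrite !mxE !mulrBr !mulrA !(gram_diag _ gN).
rewrite -signr_addb addbb mulr1 /= -!signr_addb.
rewrite !mulr1 !addbb expr0 lecE => /andP[_].
have Re_sign (c : bool) (z : R[i]) :
    complex.Re ((-1) ^+ c * z) = (-1) ^+ c * complex.Re z.
  by rewrite -Re_Creal_mul rmorph_sign.
rewrite !raddfB /= !Re_sign !signr_addb.
have := phase_re_sym i j pN; rewrite /phase_re [(-1) ^+ s i * _]mulrC; lra.
Qed.

Lemma hfidelity_phase_certificate (N : 'M[R[i]]_m) :
  gram N -> 0 < hfidelity N Phi ->
  exists q : 'I_m -> R, forall i,
    hfidelity N Phi ^+ 2 <= \sum_j phase_re N i j * q j <= 1.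
Proof.
(* A nonzero value of [minimum] is attained, which avoids any compactness. *)
move=> gN; have [pN _] := gN; rewrite /hfidelity /minimum.
case: xgetP => [F -> [[u uu <-] umin]|]; last by rewrite ltxx.
rewrite fidelity_phase // sqrtr_gt0 => Q0; rewrite sqr_sqrtr ?ltW //.
exists (sqmod u) => i; apply/andP; split.
  apply: (simplex_minimizer (H := phase_re N)).
  - by move=> k l; exact: phase_re_sym.
  - by move=> k; exact: phase_re_diag.
  - exact: sqmod_ge0.
  - exact/unitvecP.
  move=> p p0 p1; pose v : 'cV[R[i]]_m := \col_i (Num.sqrt (p i))%:C%C.
  have vp : sqmod v =1 p by exact: sqmod_sqrt.
  have uv : unitvec v.
    by apply/unitvecP; rewrite -p1; apply: eq_bigr => k _; rewrite vp.
  have := umin _ (ex_intro2 _ _ v uv erefl).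
  rewrite !fidelity_phase // => le_uv.
  (* A root of a negative number is 0, so radicands cannot be compared directly. The strict
     contrapositive needs only the larger one to be positive, which is [Q0]. *)
  rewrite leNgt; apply/negP => lt_vu.
  move: le_uv; rewrite leNgt => /negP; apply.
  rewrite ltr_sqrt //; congr (_ < _): lt_vu.
  by apply: eq_bigr => k _; apply: eq_bigr => l _; rewrite !vp.
(* Upper bound: (H q)_i is a convex combination of entries at most 1. *)
have /unitvecP <- := uu.
apply: ler_sum => j _; rewrite -[leRHS]mul1r ler_wpM2r ?sqmod_ge0 //.
exact: phase_re_le1.
Qed.

(** Each state compared with itself is pure of norm 1. Positive dimension supplies a unit vector, so
    the minimum is over a nonempty set. With [gram_phase], this makes Phi admissible in [xpoly]. *)
Lemma hfidelity_phase_refl : (0 < m)%N -> hfidelity Phi Phi = 1.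
Proof.
move=> m0.
have fid1 u : unitvec u ->
    fidelity (hadamard Phi (u *m u ^t*)) (hadamard Phi (u *m u ^t*)) = 1.
  move=> uu; rewrite hadamard_phase; set w := \col_i _.
  have ww : (w^t* *m w) 0 0 = 1.
    move: uu => /(congr1 (fun z => z ^+ 2)); rewrite sqrtCK expr1n => <-.
    rewrite dotE; apply: eq_bigr => i _.
    by rewrite mxE normrM normr_sign mul1r.
  rewrite fidelity_pure; last by rewrite -[w *m _]scale1r; exact: psdmx_outer.
  rewrite !mulmxA -mulmxA mxE big_ord1 ww mulr1 /=; exact: sqrtr1.
pose v : 'cV[R[i]]_m := delta_mx (Ordinal m0) 0.
have uv : unitvec v.
  apply/unitvecP; rewrite (bigD1 (Ordinal m0)) //= big1 ?addr0.
    by rewrite /sqmod !mxE !eqxx /= expr1n expr0n addr0.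
  by move=> i /negPf i0; rewrite /sqmod !mxE i0 /= expr0n addr0.
apply: minimum_eq => [|_ [u uu <-]]; last by rewrite fid1.
by exists v => //; exact: fid1.
Qed.

Lemma gram_phase : gram Phi.
Proof.
have PhiO : Phi = 1 *: ((\col_i (-1) ^+ s i) *m (\col_i (-1) ^+ s i)^t*).
  apply/matrixP => i j; rewrite scale1r !mxE big_ord1 !mxE PhiE.
  by rewrite rmorph_sign.
split; first by rewrite PhiO; apply: psdmx_outer.
apply/matrixP => i j; rewrite !mxE PhiE.
case: eqVneq => [->|]; rewrite ?mulr0 // mulr1 -signr_addb addbb //.
Qed.

End Phase.
End Fidelity.


(** * Fourier analysis on the cube and multilinear polynomials *)

Section Fourier.
Variables (R : realType) (n : nat).
Implicit Types (x y : cube n) (S : {set 'I_n}).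

Lemma cubevecE (g : cube n -> R[i]) i :
  (\sum_x g x *: ket x : cubecV R n) i 0 = g (enum_val i).
Proof.
rewrite summxE (bigD1 (enum_val i)) //= !mxE enum_valK !eqxx mulr1 big1 ?addr0 //.
move=> x xi; rewrite !mxE -[i in i == _]enum_valK (inj_eq enum_rank_inj).
by rewrite eq_sym (negPf xi) mulr0.
Qed.

Lemma chiE S i : (chi S : cubecV R n) i 0
  = (sqrtC (2 ^+ n))^-1 * (-1) ^+ (\sum_(k in S) enum_val i k)%N.
Proof.
by rewrite mxE cubevecE.
Qed.

(** The sum over S factors as the product over k of 1 + (-1)^(x_k + y_k); a coordinate where x and y
    differ contributes a factor 0. *)
Lemma sum_characters x y :
  \sum_(S : {set 'I_n})
    (-1) ^+ (\sum_(k in S) x k)%N * (-1) ^+ (\sum_(k in S) y k)%N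
  = (2 ^+ n *+ (x == y) : R[i]).
Proof.
pose e k : R[i] := (-1) ^+ x k * (-1) ^+ y k.
transitivity (\prod_k (e k + 1)).
  rewrite bigA_distr; apply: eq_bigr => S _.
  rewrite -big_mkcond /= big_split /=.
  by rewrite !(big_morph (fun k => (-1) ^+ k) (exprD (-1)) (expr0 _)).
have [exy|neq_xy] := eqVneq x y.
  rewrite mulr1n (eq_bigr (fun=> 2)) ?prodr_const ?card_ord // => k _.
  by rewrite /e exy -signr_addb addbb.
have [k neq_k] : exists k, x k != y k.
  apply/existsP; rewrite -negb_forall; apply: contra neq_xy => /forallP xy.
  by apply/eqP/ffunP => k; exact/eqP.
rewrite mulr0n (bigD1 k) //= /e -signr_addb.
rewrite (_ : x k (+) y k = true) ?expr1 ?addNr ?mul0r //.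
by move: neq_k; case: (x k) (y k) => -[].
Qed.

Lemma chi_complete :
  \sum_(S : {set 'I_n}) chi S *m (chi S)^t* = 1%:M :> cubemx R n.
Proof.
apply/matrixP => i j; rewrite summxE !mxE.
have c0 : sqrtC (2 ^+ n) != 0 :> R[i] by rewrite sqrtC_eq0 expf_neq0 // pnatr_eq0.
transitivity ((2 ^+ n)^-1 * (2 ^+ n *+ (enum_val i == enum_val j)) : R[i]).
  rewrite -sum_characters mulr_sumr; apply: eq_bigr => S _.
  have -> : (chi S *m (chi S)^t*) i j = chi S i 0 * (chi S j 0)^* :> R[i].
    by rewrite mxE big_ord1 [X in _ * X]mxE [X in X^*]mxE.
  rewrite !chiE rmorphM /= rmorphXn rmorphN1.
  rewrite fmorphV /= conj_Creal ?ger0_real ?sqrtC_ge0 ?exprn_ge0 ?ler0n //.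
  rewrite -[X in _ = X^-1 * _]sqrtCK.
  move: (_ ^+ _)%R (_ ^+ _)%R (sqrtC _) c0 => a b c c0; field; exact: c0.
have -> : (enum_val i == enum_val j) = (i == j).
  by apply/eqP/eqP => [/enum_val_inj|->].
case: eqVneq => _; rewrite ?mulr0n ?mulr0 //.
by rewrite mulr1n mulVf // expf_neq0 // pnatr_eq0.
Qed.

(** Inserting [chi_complete] in front of N b gives the coefficients <chi_S|N|b>, which vanish by
    [psdmx_ker] for S larger than [xpoly0 N]. Characters are real, so real parts can be taken
    coefficientwise. *)
Lemma fourier_support (N : cubemx R n) (b : cubecV R n) : psdmx N ->
  exists c : {set 'I_n} -> R,
    (forall S, (xpoly0 N < #|S|)%N -> c S = 0) /\
    forall x, complex.Re ((N *m b) (enum_rank x) 0)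
      = \sum_(S : {set 'I_n}) c S * (-1) ^+ (\sum_(k in S) x k)%N.
Proof.
move=> pN; pose h S : R[i] := ((chi S)^t* *m N *m b) 0 0 / sqrtC (2 ^+ n).
exists (fun S => complex.Re (h S)); split => [S dS|x].
  have /eqP NS : ((chi S)^t* *m N *m chi S) 0 0 == 0.
    apply: contraLR dS => NS; rewrite -leqNgt.
    by rewrite /xpoly0 (bigD1 S) //= leq_max leqnn.
  by rewrite /h (psdmx_ker pN NS) mul0mx mxE mul0r.
rewrite -[N *m b]mul1mx -chi_complete mulmx_suml summxE Re_sum.
apply: eq_bigr => S _; rewrite -mulmxA mxE big_ord1 chiE enum_rankK mulmxA.
have -> : (-1) ^+ (\sum_(k in S) x k)%N
    = ((-1) ^+ (\sum_(k in S) x k)%N : R)%:C%C :> R[i].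
  by rewrite rmorphXn rmorphN1.
rewrite mulrAC mulrC Re_Creal_mul mulrC; congr (complex.Re _ * _).
by rewrite mulrC.
Qed.

Lemma msizeM_pred (p q : {mpoly R[n]}) :
  ((msize (p * q)).-1 <= (msize p).-1 + (msize q).-1)%N.
Proof.
have [->|p0] := eqVneq p 0; first by rewrite mul0r msize0.
have [->|q0] := eqVneq q 0; first by rewrite mulr0 msize0.
rewrite msizeM //; move: p0 q0; rewrite -!msize_poly_eq0.
by case: (msize p) (msize q) => [//|k] [//|l] _ _; rewrite addnS.
Qed.

(** On the cube (-1)^(x_k) = 1 - 2 x_k, so the character of S agrees there with a product of |S|
    affine factors. *)
Lemma multilinear_polynomial (c : {set 'I_n} -> R) d :
  (forall S, (d < #|S|)%N -> c S = 0) ->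
  exists2 p : {mpoly R[n]}, ((msize p).-1 <= d)%N &
    forall x, meval (fun i => (x i)%:R) p
      = \sum_(S : {set 'I_n}) c S * (-1) ^+ (\sum_(k in S) x k)%N.
Proof.
move=> cd; pose P S : {mpoly R[n]} := \prod_(k in S) (1 - 2%:R *: 'X_k).
exists (\sum_(S : {set 'I_n}) c S *: P S).
  have msizeP S : ((msize (P S)).-1 <= #|S|)%N.
    rewrite -sum1_card /P; elim/big_rec2: _ => [|k q p _ IH]; first by rewrite msize1.
    apply: leq_trans (msizeM_pred _ _) _; apply: leq_add => //.
    suff : (msize (1 - 2%:R *: 'X_k : {mpoly R[n]}) <= 2)%N by case: (msize _).
    apply: leq_trans (msizeD_le _ _) _; rewrite msizeN msize1 geq_max /=.
    by rewrite (leq_trans (msizeZ_le _ _)) // msizeX mdeg1.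
  (* Bounding [msize] by [d.+1] instead of its predecessor by d lets [msize_sum] apply and absorbs
     the zero polynomial. *)
  suff : (msize (\sum_(S : {set 'I_n}) c S *: P S) <= d.+1)%N by case: (msize _).
  apply: leq_trans (msize_sum _ _ _) _; apply/bigmax_leqP => S _.
  have [/cd ->|le_S] := ltnP d #|S|; first by rewrite scale0r msize0.
  apply: leq_trans (msizeZ_le _ _) _; have := leq_trans (msizeP S) le_S.
  by case: (msize _).
move=> x; rewrite raddf_sum; apply: eq_bigr => S _; rewrite /= mevalZ; congr (_ * _).
rewrite rmorph_prod /= (big_morph (fun k => (-1) ^+ k) (exprD (-1)) (expr0 _)).
apply: eq_bigr => k _; rewrite mevalB meval1 mevalZ mevalXU.
by case: (x k) => /=; rewrite ?mulr1n ?mulr0n; ring.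
Qed.
End Fourier.

(** * The phase Gram matrix of f and the degree bound *)

Lemma phase_gramE (R : realType) (n : nat) (f : cube n -> bool) i j :
  phase_gram R f i j = (-1) ^+ f (enum_val i) * (-1) ^+ f (enum_val j).
Proof.
have ketE x x' : (ket x' *m (ket x)^t*) i j
    = (enum_val i == x')%:R * (enum_val j == x)%:R :> R[i].
  rewrite mxE big_ord1 [X in X * _]mxE [X in _ * X]mxE [X in X^*]mxE [X in X^*]mxE.
  by rewrite !andbT rmorph_nat -!(can2_eq enum_valK enum_rankK).
rewrite summxE (bigD1 (enum_val j)) //= [X in _ + X]big1 ?addr0 => [|x xj].
  rewrite summxE (bigD1 (enum_val i)) //= big1 ?addr0 => [|x xi].
    by rewrite mxE ketE !eqxx !mulr1 mulrC.
  by rewrite mxE ketE eq_sym (negPf xi) mul0r mulr0.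
rewrite summxE big1 // => y _.
by rewrite mxE ketE [_ == x]eq_sym (negPf xj) !mulr0.
Qed.

Theorem theorem13 (R : realType) (n : nat) (f : {ffun 'I_n -> bool} -> bool)
  (eps : R) (eps_ge0 : 0 <= eps) (eps_le1 : eps <= 1) :
  (xpoly eps (phase_gram R f) >= approx_deg (eps / 2%:R) f)%N.
Proof.
pose s (i : 'I_#|{: cube n}|) := f (enum_val i).
have PhiE : forall i j, _ = (-1) ^+ s i * (-1) ^+ s j := phase_gramE R f.
have cube_gt0 : (0 < #|{: cube n}|)%N.
  by apply/card_gt0P; exists [ffun=> false].
rewrite /xpoly; set E := (X in (_ <= minimum _ X)%N).
(* Phi itself is admissible, with Hadamard fidelity 1, so the minimum is attained by some N and is
   not a default value. *)
have [N [hN gN] xN] : E (minimum 0%N E).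
  apply: (proj1 (minimum_nat _ (ex_intro2 _ _ (phase_gram R f) _ erefl))).
  split; last exact: gram_phase PhiE.
  rewrite (hfidelity_phase_refl PhiE) // -[leRHS]sqrtr1 ler_wsqrtr //.
  by rewrite gerBl.
rewrite -xN.
suff [p dp pf] : exists2 p : {mpoly R[n]}, ((msize p).-1 <= xpoly0 N)%N &
    forall x : cube n, `|meval (fun i => (x i)%:R) p - (f x)%:R| <= eps / 2%:R.
  apply: leq_trans dp; apply: (proj2 (minimum_nat _ _)).
  by exists p.
(* For eps = 1 the bound on [hfidelity] is void, but the constant 1/2 works. *)
have [eps1|eps_neq1] := eqVneq eps 1.
  exists (2%:R^-1)%:MP => [|x].
    by rewrite msizeC; case: eqP.
  rewrite mevalC eps1 ler_norml; case: (f x) => /=; lra.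
have hpos : 0 < hfidelity N (phase_gram R f).
  by apply: lt_le_trans hN; rewrite sqrtr_gt0 subr_gt0 lt_neqAle eps_neq1.
have [q qP] := hfidelity_phase_certificate PhiE gN hpos.
have le_eps : 1 - eps <= hfidelity N (phase_gram R f) ^+ 2.
  rewrite -[leLHS]sqr_sqrtr ?subr_ge0 // lerXn2r // ?nnegrE ?sqrtr_ge0 //.
  exact: ltW.
(* Moving the column signs of H into b gives (H q)_x = s_x Re (N b)_x. *)
pose b : cubecV R n := \col_j ((-1) ^+ s j * q j)%:C%C.
have [c [c0 cE]] := fourier_support b (proj1 gN).
have [p dp pE] := multilinear_polynomial c0.
(* On the cube p is within eps of (-1)^f, and f = (1 - (-1)^f) / 2; the halving turns eps into eps /
   2. *)
exists (2%:R^-1 *: (1 - p)) => [|x].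
  have : (msize (2%:R^-1 *: (1 - p)) <= (xpoly0 N).+1)%N.
    apply: leq_trans (msizeZ_le _ _) _; apply: leq_trans (msizeD_le _ _) _.
    by rewrite msizeN msize1 geq_max /=; move: dp; case: (msize p).
  by case: (msize _).
rewrite mevalZ mevalB meval1 pE -cE.
have := qP (enum_rank x).
have -> : \sum_j phase_re s N (enum_rank x) j * q j
    = (-1) ^+ f x * complex.Re ((N *m b) (enum_rank x) 0).
  rewrite mxE Re_sum mulr_sumr; apply: eq_bigr => j _.
  rewrite mxE [N _ _ * _]mulrC Re_Creal_mul /phase_re {1}/s enum_rankK.
  by rewrite mulrAC !mulrA.
move: (complex.Re _) => g; rewrite ler_norml.
case: (f x) => /= /andP[]; rewrite ?expr1 ?expr0; lra.
Qed.
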